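(* Consider the one-dimensional deterministic linear quadratic mean field game of controls described in the context, with parameters $T>0$, $\gamma>0$, $\kappa\ne0$, $\kappa\ne-(1+\gamma)$, $\varrho\ne0$, and Gaussian initial density with mean $\mu(0)$. Let $1+\kappa+\gamma+T(1+\varrho)=0$ and $\mu(0)=0$. Then the displacement semimonotonicity condition (D) in the context is violated and the corresponding linear quadratic mean field game system has infinitely many solutions.
   Context: Costs ($d=1$, no noise): for $a,x\in\mathbb R$, $\nu\in\mathcal P_2(\mathbb R)$ (law of controls) and $m\in\mathcal P_2(\mathbb R)$ (law of states), $$L(a,\nu)=\frac12\Bigl(a+\kappa\int_{\mathbb R}A\,d\nu(A)\Bigr)^2+\frac{\gamma a^2}{2},\qquad g(x,m)=\frac12\Bigl(x+\varrho\int_{\mathbb R}y\,dm(y)\Bigr)^2,$$ with Hamiltonian $H(p,\nu)=\max_{a\in\mathbb R}\{-pa-L(a,\nu)\}=\frac{p^2}{2(\gamma+1)}+\frac{\kappa p}{\gamma+1}\int A\,d\nu(A)-\frac{\gamma\kappa^2}{2(\gamma+1)}\bigl(\int A\,d\nu(A)\bigr)^2$. Mean field game system: $$\begin{cases}-\partial_tv(t,x)+H(D_xv(t,x),\nu_t)=0&\text{in }(0,T)\times\mathbb R,\\ \partial_tm_t-\nabla\cdot(m_tD_pH(D_xv,\nu_t))=0&\text{in }(0,T)\times\mathbb R,\\ \nu_t=(-D_pH(D_xv(t,\cdot),\nu_t))_\sharp m_t&\text{in }[0,T],\\ v(T,x)=g(x,m_T),\quad m(0,x)=\frac{s(0)}{\sqrt\pi}\exp\bigl(-(s(0)(x-\mu(0)))^2\bigr),\end{cases}$$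 with given $s(0)>0$, $\mu(0)\in\mathbb R$. A solution consists of $v\in C^1([0,T]\times\mathbb R)$ solving the first equation classically, $m\in C([0,T];\mathcal P_2(\mathbb R))$ solving the second in the distributional sense, and a continuous flow $\nu$ satisfying the third equation. Condition (D) (displacement semimonotonicity): there exist constants $C_{L,a}>0$, $C_{L,x},C_g\ge0$ with $C_{L,a}-TC_g-\frac{T^2}2C_{L,x}>0$ such that for all real-valued $X,\overline X,\alpha,\overline\alpha\in L^2(\Omega)$ ($\Omega$ atomless; here $D_xL=0$; $\mathcal L(\cdot)$ denotes the law) $$\mathbb E\bigl[(D_aL(\alpha,\mathcal L(\alpha))-D_aL(\overline\alpha,\mathcal L(\overline\alpha)))(\alpha-\overline\alpha)\bigr]\ge C_{L,a}\mathbb E|\alpha-\overline\alpha|^2-C_{L,x}\mathbb E|X-\overline X|^2,$$ $$\mathbb E\bigl[(D_xg(X,\mathcal L(X))-D_xg(\overline X,\mathcal L(\overline X)))(X-\overline X)\bigr]\ge-C_g\mathbb E|X-\overline X|^2.$$ *)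

(* Defs.v *)
From mathcomp Require Import all_boot all_order all_algebra.
From mathcomp Require Import all_classical all_reals all_analysis.
From mathcomp Require Import ring lra.

Set Implicit Arguments.
Unset Strict Implicit.
Unset Printing Implicit Defensive.

Import Order.TTheory GRing.Theory Num.Theory.
Import numFieldNormedType.Exports.

Local Open Scope classical_set_scope.
Local Open Scope ring_scope.

Section Laws.
Context {R : realType}.

Definition law := probability (measurableTypeR R) R.

Definition P2 : set law := [set m | (\int[m]_x ((x : R) ^+ 2)%:E < +oo)%E].

Definition mean (m : law) : R := \int[m]_x (x : R).

Definition coupling (m1 m2 : law) :
    set (probability (measurableTypeR R * measurableTypeR R)%type R) :=
  [set pi | forall A : set (measurableTypeR R), measurable A ->
     pushforward pi fst A = m1 A /\ pushforward pi snd A = m2 A].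

Definition W2 (m1 m2 : law) : \bar R :=
  ((ereal_inf [set (\int[pi]_z (((z.1 : R) - z.2) ^+ 2)%:E)%E
             | pi in coupling m1 m2]) `^ 2^-1)%E.

(* C([0,T]; P_2(R)), with P_2(R) metrized by W2. Values off [0,T] are
   irrelevant. *)
Definition P2_flow (T : R) (m : R -> law) : Prop :=
  (forall t, t \in `[0, T] -> P2 (m t)) /\
  (forall t, t \in `[0, T] ->
     W2 (m s) (m t) @[s --> within `[0, T] (nbhs t)] --> 0%E).

End Laws.
Arguments law : clear implicits.

Section Costs.
Context {R : realType}.
Variables gamma kappa rho : R.

Definition L (a : R) (nu : law R) : R :=
  2^-1 * (a + kappa * mean nu) ^+ 2 + gamma * a ^+ 2 / 2.

Definition g (x : R) (m : law R) : R := 2^-1 * (x + rho * mean m) ^+ 2.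

(* The supremum is a maximum for gamma > 0, see hamiltonianE. *)
Definition H (p : R) (nu : law R) : R :=
  sup (range (fun a => - p * a - L a nu)).

Definition DaL (a : R) (nu : law R) : R := derive1 (L ^~ nu) a.

Definition Dxg (x : R) (m : law R) : R := derive1 (g ^~ m) x.

Definition DpH (p : R) (nu : law R) : R := derive1 (H ^~ nu) p.

Lemma hamiltonianE (p : R) (nu : law R) : 0 < gamma ->
  H p nu = p ^+ 2 / (2 * (gamma + 1)) + kappa * p / (gamma + 1) * mean nu
           - gamma * kappa ^+ 2 / (2 * (gamma + 1)) * mean nu ^+ 2
  /\ exists a, H p nu = - p * a - L a nu.
Proof.
move=> g0; set c := mean nu; have g1 : gamma + 1 != 0 by rewrite gt_eqF// addr_gt0.
pose a0 := - (p + kappa * c) / (gamma + 1).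
have -> : H p nu = - p * a0 - L a0 nu.
  apply/eqP; rewrite eq_le; apply/andP; split.
    apply: ge_sup; first by exists (- p * 0 - L 0 nu), 0.
    move=> _ [a _ <-]; rewrite -subr_ge0.
    suff -> : - p * a0 - L a0 nu - (- p * a - L a nu)
        = (gamma + 1) / 2 * (a - a0) ^+ 2.
      by rewrite mulr_ge0 ?sqr_ge0// divr_ge0// addr_ge0// ltW.
    by rewrite /L -/c /a0; field.
  apply: ub_le_sup; last by exists a0.
  exists (- p * a0 - L a0 nu) => _ [a _ <-]; rewrite -subr_ge0.
  suff -> : - p * a0 - L a0 nu - (- p * a - L a nu)
      = (gamma + 1) / 2 * (a - a0) ^+ 2.
    by rewrite mulr_ge0 ?sqr_ge0// divr_ge0// addr_ge0// ltW.
  by rewrite /L -/c /a0; field.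
by split; [rewrite /L -/c /a0; field | exists a0].
Qed.

End Costs.

Definition atomless {d} {Om : measurableType d} {R : realType}
    (P : probability Om R) : Prop :=
  forall A : set Om, measurable A -> (0 < P A)%E ->
    exists B, [/\ measurable B, B `<=` A, (0 < P B)%E & (P B < P A)%E].

Section Displacement.
Context {R : realType}.
Variables (T gamma kappa rho : R).
Context {d} {Om : measurableType d} (P : probability Om R).

Local Notation DaL := (DaL gamma kappa).
Local Notation Dxg := (Dxg rho).

Definition L2 (X : {RV P >-> measurableTypeR R}) : Prop :=
  (X : Om -> R) \in Lfun P 2%:E.

Definition law_of (X : {RV P >-> measurableTypeR R}) : law R := distribution P X.

Definition displacement_semimonotone : Prop :=
  exists CLa CLx Cg : R,
  [/\ 0 < CLa, 0 <= CLx, 0 <= Cg,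
      0 < CLa - T * Cg - T ^+ 2 / 2 * CLx &
      forall X X' al al' : {RV P >-> measurableTypeR R},
        L2 X -> L2 X' -> L2 al -> L2 al' ->
        (CLa%:E * 'E_P[(fun w => `|(al w : R) - al' w| ^+ 2)%R]
           - CLx%:E * 'E_P[(fun w => `|(X w : R) - X' w| ^+ 2)%R]
         <= 'E_P[(fun w => (DaL (al w) (law_of al) - DaL (al' w) (law_of al'))
                          * (al w - al' w))%R])%E /\
        (- Cg%:E * 'E_P[(fun w => `|(X w : R) - X' w| ^+ 2)%R]
         <= 'E_P[(fun w => (Dxg (X w) (law_of X) - Dxg (X' w) (law_of X'))
                          * (X w - X' w))%R])%E].

End Displacement.

Section System.
Context {R : realType}.

(* v is C^1 on [0,T] x R: continuous there, with continuous partial derivatives.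
   The time derivative is asked for on ]0,T[ only, with a continuous extension
   w to [0,T] x R, which at t = 0 and t = T is then the one-sided derivative. *)
Definition C1 (T : R) (v : R -> R -> R) : Prop :=
  let D : set (R * R) := `[0, T] `*` setT in
  [/\ {within D, continuous (fun z => v z.1 z.2)},
      forall t x, t \in `[0, T] -> derivable (v t) x 1,
      {within D, continuous (fun z => derive1 (v z.1) z.2)} &
      exists w : R * R -> R, {within D, continuous w} /\
        forall t x, t \in `]0, T[ -> is_derive t 1 (v ^~ x) (w (t, x))].

(* Directions of time (false) and space (true) for functions of z = (t, x). *)
Definition dir (b : bool) : R^o * R^o := if b then (0, 1) else (1, 0).

Definition partial (b : bool) (phi : R^o * R^o -> R^o) : R^o * R^o -> R^o :=
  fun z => 'D_(dir b) phi z.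

Definition smooth (phi : R^o * R^o -> R^o) : Prop :=
  forall s : seq bool,
    continuous (foldr partial phi s) /\
    forall b z, derivable (foldr partial phi s) z (dir b).

Definition test_function (T : R) (phi : R^o * R^o -> R^o) : Prop :=
  smooth phi /\
  exists K : set (R^o * R^o),
    [/\ compact K, K `<=` `]0, T[ `*` setT & forall z, ~ K z -> phi z = 0].

(* d_t m + d_x (m b) = 0 on ]0,T[ x R in the sense of distributions. *)
Definition continuity_equation (T : R) (m : R -> law R) (b : R -> R -> R) : Prop :=
  forall phi, test_function T phi ->
    \int[lebesgue_measure]_(t in `]0, T[)
      (\int[m t]_x (partial false phi (t, x : R)
                    + b t x * partial true phi (t, x : R))) = 0.

Variables (T gamma kappa rho s0 mu0 : R).

Local Notation DpH := (DpH gamma kappa).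

Definition initial_density (x : R) : R :=
  s0 / Num.sqrt pi * expR (- (s0 * (x - mu0)) ^+ 2).

Definition mfg_solution (v : R -> R -> R) (m nu : R -> law R) : Prop :=
  [/\ C1 T v, P2_flow T m & P2_flow T nu] /\
  [/\ forall t x, t \in `]0, T[ ->
        - derive1 (v ^~ x) t + H gamma kappa (derive1 (v t) x) (nu t) = 0,
      continuity_equation T m (fun t x => - DpH (derive1 (v t) x) (nu t)),
      forall t, t \in `[0, T] ->
        forall A : set (measurableTypeR R), measurable A ->
          nu t A = pushforward (m t) (fun x : measurableTypeR R =>
                     - DpH (derive1 (v t) x) (nu t) : measurableTypeR R) A,
      forall x, v T x = g rho x (m T) &
      forall A : set (measurableTypeR R), measurable A ->
        m 0 A = (\int[lebesgue_measure]_(x in A) (initial_density x)%:E)%E].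

(* Solutions are compared as maps on [0,T], and their measures as maps on Borel
   sets: values off [0,T], or those a measure of the library also takes on
   non-measurable sets, do not distinguish two solutions. *)
Definition borel : set (set (measurableTypeR R)) := measurable.

Definition restrict_flow (m : R -> law R) : `[0, T]%classic -> borel -> \bar R :=
  fun t => sigL borel (sigL `[0, T] m t).

Definition mfg_solutions :
    set ((`[0, T]%classic -> R -> R) * (`[0, T]%classic -> borel -> \bar R)
         * (`[0, T]%classic -> borel -> \bar R)) :=
  [set z | exists v m nu, mfg_solution v m nu /\
     z = (sigL `[0, T] v, restrict_flow m, restrict_flow nu)].

End System.
Arguments mfg_solutions {R} T gamma kappa rho s0 mu0.

(* Main.v *)
From HB Require Import structures.
From mathcomp Require Import all_boot all_order all_algebra.
From mathcomp Require Import all_classical all_reals all_analysis.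
From mathcomp Require Import measurable_realfun.
From mathcomp Require Import ring lra.
Require Import Defs.

(** Write n = gamma + 1. On deterministic controls and states only the means
    count: the derivative of L has monotonicity constant n + kappa there, and
    that of g has 1 + rho. Resonance says n + kappa = - T * (1 + rho), whereas
    condition (D) forces C_La <= n + kappa and - C_g <= 1 + rho, hence
    C_La - T * C_g <= 0 ([resonance_not_semimonotone]).

    The same resonance makes the mean velocity of the population undetermined.
    Along an optimal trajectory the momentum D_x v is constant, so that agents
    move on straight lines. If c is the mean control and the initial mean is 0,
    the terminal mean is T * c, the mean momentum is (1 + rho) * T * c, and the
    fixed point equation for the mean of the controls becomes
    (n + kappa) * c = - (1 + rho) * T * c, which resonance turns into an
    identity. Every real c therefore gives a solution:
    - the value function is the quadratic Hopf-Lax solution [value], which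
      solves the Hamilton-Jacobi equation whenever the controls have mean c;
    - the feedback is constant along the lines
      t |-> x + t * (c - x / (n + T)) ([drift_along_line], the one place where
      resonance enters the construction);
    - the state law m_t and the control law nu_t are images of the initial
      Gaussian under affine maps, so that W2-continuity follows by coupling the
      two images through the common initial point ([affine_flow]), and the
      continuity equation by integrating d/dt phi (t, X_t x) in t and x
      ([affine_law_continuity_equation]).
    Finally v (T, x) = (x + rho * T * c) ^ 2 / 2 determines c because rho and T
    are nonzero, so that distinct means give distinct solutions. *)

Set Implicit Arguments.
Unset Strict Implicit.
Unset Printing Implicit Defensive.

Import Order.TTheory GRing.Theory Num.Theory.
Import numFieldNormedType.Exports.
Local Open Scope classical_set_scope.
Local Open Scope ring_scope.

(** * Failure of displacement semimonotonicity *)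

Lemma derive_L {R : realType} (gamma kappa a : R) (nu : law R) :
  DaL gamma kappa a nu = (1 + gamma) * a + kappa * mean nu.
Proof.
rewrite /DaL derive1E /L; apply: derive_val.
by apply: is_derive_eq; rewrite /GRing.scale/=; field.
Qed.

Lemma derive_g {R : realType} (rho x : R) (m : law R) :
  Dxg rho x m = x + rho * mean m.
Proof.
rewrite /Dxg derive1E /g; apply: derive_val.
by apply: is_derive_eq; rewrite /GRing.scale/=; field.
Qed.

Section Semimonotone.
Context {R : realType} {d : measure_display} {Om : measurableType d}.
Variable P : probability Om R.

Lemma expectation_constant (f : Om -> R) r : (forall w, f w = r) ->
  ('E_P[f] = r%:E)%E.
Proof.
by move=> fr; rewrite -(expectation_cst P r); congr expectation; apply/funext.
Qed.

Definition cst_rv (c : R) : {RV P >-> measurableTypeR R} :=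
  [the {mfun Om >-> measurableTypeR R} of cst (c : measurableTypeR R)].

Lemma cst_rv_L2 c : L2 (cst_rv c).
Proof. by rewrite /L2; exact: Lfun_cst. Qed.

Lemma mean_cst_rv c : mean (law_of (cst_rv c)) = c.
Proof.
rewrite /mean /Rintegral integral_distribution.
- by rewrite /= integral_cst//= probability_setT mule1.
- by apply/measurable_EFinP; exact: measurable_id.
- exact: finite_measure_integrable_cst.
Qed.

(** Test (D) on the constants 1 and 0: controls 1 and 0 at equal states in the
    first inequality, states 1 and 0 in the second. *)
Lemma resonance_not_semimonotone (T gamma kappa rho : R) : 0 < T ->
  1 + kappa + gamma + T * (1 + rho) = 0 ->
  ~ displacement_semimonotone T gamma kappa rho P.
Proof.
move=> T0 res [CLa [CLx [Cg [CLa0 CLx0 Cg0 gap mono]]]].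
have [ineqL _] := mono _ _ _ _ (cst_rv_L2 0) (cst_rv_L2 0)
  (cst_rv_L2 1) (cst_rv_L2 0).
have [_ ineqg] := mono _ _ _ _ (cst_rv_L2 1) (cst_rv_L2 0)
  (cst_rv_L2 0) (cst_rv_L2 0).
have {}ineqL : CLa <= 1 + gamma + kappa.
  move: ineqL; rewrite (@expectation_constant _ 1); last first.
    by move=> w; rewrite /= subr0 normr1 expr1n.
  rewrite (@expectation_constant _ 0); last first.
    by move=> w; rewrite /= subr0 normr0 expr0n.
  rewrite (@expectation_constant _ (1 + gamma + kappa)); last first.
    by move=> w; rewrite !derive_L !mean_cst_rv /=; ring.
  by rewrite -!EFinM -EFinB lee_fin mulr1 mulr0 subr0.
have {}ineqg : - Cg <= 1 + rho.
  move: ineqg; rewrite (@expectation_constant _ 1); last first.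
    by move=> w; rewrite /= subr0 normr1 expr1n.
  rewrite (@expectation_constant _ (1 + rho)); last first.
    by move=> w; rewrite !derive_g !mean_cst_rv /=; ring.
  by rewrite -EFinN -EFinM lee_fin mulr1.
have := mulr_ge0 (sqr_ge0 T) CLx0.
nra.
Qed.

End Semimonotone.

(** * The Gaussian initial law *)

Section Density.
Context d (T : measurableType d) (R : realType).
Variables (nu : {finite_measure set T -> \bar R})
          (mu : {sigma_finite_measure set T -> \bar R}) (p : T -> \bar R).

(** The Radon-Nikodym derivative of nu is determined almost everywhere, so it
    may be replaced by the given density p. *)
Lemma ge0_integral_density (f : T -> \bar R) :
  mu.-integrable setT p ->
  (forall A, measurable A -> nu A = \int[mu]_(x in A) p x)%E ->
  measurable_fun setT f -> (forall x, 0 <= f x)%E ->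
  (\int[nu]_x f x = \int[mu]_x (f x * p x))%E.
Proof.
move=> ip nuE mf f0.
have numu : nu `<< mu.
  apply/null_content_dominatesP => A mA muA0; rewrite nuE//.
  by apply: null_set_integral => //; exact/measurable_funTS/(measurable_int mu).
rewrite -(Radon_Nikodym_SigmaFinite.change_of_variables numu)//.
have ig := Radon_Nikodym_SigmaFinite.f_integrable numu.
apply: ae_eq_integral => //.
- by apply: emeasurable_funM => //; exact: measurable_int ig.
- by apply: emeasurable_funM => //; exact: measurable_int ip.
- apply: ae_eqe_mul2l; apply: integral_ae_eq => //.
    exact: measurable_int ip.
  by move=> A _ mA; rewrite -nuE// -Radon_Nikodym_SigmaFinite.f_integral.
Qed.
End Density.

Section SecondMoment.
Context {R : realType}.
Implicit Type m : law R.

Definition second_moment m : \bar R := (\int[m]_x ((x : R) ^+ 2)%:E)%E.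

(** [P2] integrates over R with its default measurable structure, which differs
    from that of [measurableTypeR R] by its display only. The two integrals are
    identified by transporting along the identity map. *)
Lemma P2E m : P2 m <-> (second_moment m < +oo)%E.
Proof.
rewrite /second_moment.
have mid : @measurable_fun _ _ (measurableTypeR R) R setT id.
  by move=> _ Y mY; rewrite setTI preimage_id.
have /= E := @ge0_integral_pushforward _ _ (measurableTypeR R) R R id mid m
  setT (fun x => (x ^+ 2)%:E) measurableT.
rewrite -E//.
- by apply/measurable_EFinP; exact: exprn_measurable.
- by move=> x _; rewrite lee_fin sqr_ge0.
Qed.

End SecondMoment.

Section Gaussian.
Context {R : realType}.
Implicit Types s x : R.

Definition gaussian s : law R := normal_prob 0 s.

(** s0 is an inverse width: the standard deviation is 1 / (s0 * sqrt 2). *)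
Lemma initial_density_gaussian s0 x : 0 < s0 ->
  initial_density s0 0 x = normal_pdf 0 (s0 * Num.sqrt 2)^-1 x.
Proof.
move=> s0_gt0; set s := (s0 * _)^-1.
have sp : 0 < s by rewrite invr_gt0 mulr_gt0// sqrtr_gt0.
have s2 : s ^+ 2 *+ 2 = (s0 ^+ 2)^-1.
  rewrite /s exprVn exprMn sqr_sqrtr//; field.
  by rewrite gt_eqF.
rewrite normal_pdfE ?gt_eqF// /initial_density /normal_fun /normal_peak.
rewrite -mulrnAl s2 sqrtrM ?invr_ge0 ?sqr_ge0// sqrtrV ?sqr_ge0//.
rewrite sqrtr_sqr gtr0_norm// invfM invrK subr0.
by rewrite invrK exprMn mulNr mulrC (mulrC (x ^+ 2)) mulrC.
Qed.

(** Since y * expR (- y) <= 1, x ^ 2 times the Gaussian density of deviation s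
    is at most a constant times the Gaussian density of deviation s * sqrt 2. *)
Lemma gaussian_P2 s : 0 < s -> P2 (gaussian s).
Proof.
move=> s0.
have E : (\int[gaussian s]_x ((x : R) ^+ 2)%:E =
    \int[lebesgue_measure]_x ((x ^+ 2)%:E * (normal_pdf 0 s x)%:E))%E.
  apply: ge0_integral_density.
  - exact: integrable_normal_pdf.
  - by [].
  - by apply/measurable_EFinP; exact: exprn_measurable.
  - by move=> x; rewrite lee_fin sqr_ge0.
apply/P2E; rewrite /second_moment E.
pose C : R := 4 * s ^+ 2 * normal_peak s / normal_peak (s * Num.sqrt 2).
have s2 : 0 < s * Num.sqrt 2 by rewrite mulr_gt0// sqrtr_gt0.
apply: (@le_lt_trans _ _
    (\int[lebesgue_measure]_x (C * normal_pdf 0 (s * Num.sqrt 2) x)%:E)%E).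
  apply: ge0_le_integral => //.
  - by move=> x _; rewrite -EFinM lee_fin mulr_ge0// ?sqr_ge0// normal_pdf_ge0.
  - apply/measurable_EFinP/measurable_funM; first exact: exprn_measurable.
    exact: measurable_normal_pdf.
  - apply/measurable_EFinP/measurable_funM => //.
    exact: measurable_normal_pdf.
  move=> x _; rewrite -EFinM lee_fin !normal_pdfE ?gt_eqF// /C.
  rewrite [leRHS]mulrA divfK ?gt_eqF ?normal_peak_gt0 ?gt_eqF//.
  rewrite mulrCA (mulrC (4 * _)) -[leRHS]mulrA ler_wpM2l ?normal_peak_ge0//.
  rewrite /normal_fun subr0 !mulNr exprMn sqr_sqrtr//.
  (* the exponent is 2 y: one half absorbs x ^ 2, the other is the exponent of
     the wider Gaussian *)
  set y := x ^+ 2 / (s ^+ 2 * 2 *+ 2).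
  have sn : s != 0 by rewrite gt_eqF.
  have -> : x ^+ 2 / (s ^+ 2 *+ 2) = y + y by rewrite /y; field.
  have -> : x ^+ 2 = 4 * s ^+ 2 * y by rewrite /y; field.
  rewrite opprD expRD mulrA ler_wpM2r ?expR_ge0//.
  rewrite -[leLHS]mulrA -[leRHS]mulr1 ler_wpM2l//.
    by rewrite mulr_ge0// sqr_ge0.
  rewrite expRN ler_pdivrMr ?expR_gt0// mul1r.
  by have := expR_ge1Dx y; lra.
under eq_integral do rewrite EFinM.
rewrite integralZl//; last exact: integrable_normal_pdf.
by rewrite integral_normal_pdf mule1 ltry.
Qed.

End Gaussian.

Section Means.
Context {R : realType}.
Implicit Type m : law R.

Lemma P2_integrable m : P2 m -> m.-integrable setT (fun x => (x : R)%:E).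
Proof.
move=> /P2E m2; apply/integrableP; split.
  by apply/measurable_EFinP; exact: measurable_id.
apply: (@le_lt_trans _ _ (\int[m]_x (1%:E + ((x : R) ^+ 2)%:E))%E).
  apply: ge0_le_integral => //.
  - by apply/measurableT_comp => //; apply/measurable_EFinP;
      exact: measurable_id.
  - apply: emeasurable_funD => //.
    by apply/measurable_EFinP; exact: exprn_measurable.
  - move=> x _; rewrite -EFinD abse_EFin lee_fin.
    have := sqr_ge0 (`|x| - 1); rewrite sqrrB real_normK ?num_real//.
    by have := normr_ge0 x; lra.
rewrite ge0_integralD//; first last.
- by apply/measurable_EFinP; exact: exprn_measurable.
- by move=> x _; rewrite lee_fin sqr_ge0.
rewrite integral_cst//= probability_setT mule1.
by rewrite lte_add_pinfty// ltry.
Qed.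

Lemma Rintegral_affine m a b : P2 m ->
  \int[m]_x (a * (x : R) + b) = a * mean m + b.
Proof.
move=> /P2_integrable im.
have i1 : m.-integrable setT (fun x => (a * (x : R))%:E).
  by under eq_fun do rewrite EFinM; exact: integrableZl.
have ic : m.-integrable setT (EFin \o cst b).
  exact: finite_measure_integrable_cst.
rewrite RintegralD// RintegralZl// Rintegral_cst//.
by rewrite /= probability_setT mulr1.
Qed.

(** The law is invariant under x |-> - x. *)
Lemma gaussian_mean (s : R) : 0 < s -> mean (gaussian s) = 0.
Proof.
move=> s0; have im := P2_integrable (gaussian_P2 s0).
suff : mean (gaussian s) = - mean (gaussian s) by lra.
rewrite -[RHS]addr0 -mulN1r -(Rintegral_affine (-1) 0 (gaussian_P2 s0)).
under [RHS]eq_Rintegral do rewrite mulN1r addr0.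
rewrite /mean /Rintegral; congr fine.
pose opp : measurableTypeR R -> measurableTypeR R := -%R.
have mopp : measurable_fun setT opp by exact: oppr_measurable.
transitivity (\int[pushforward (gaussian s) opp]_x (x : R)%:E)%E; last first.
  rewrite integral_pushforward// preimage_setT.
  under [X in integrable _ _ X]eq_fun do rewrite /opp/= EFinN.
  exact: integrableN.
apply: eq_measure_integral => //= A mA _.
rewrite /gaussian/= /normal_prob /pushforward.
have E := @ge0_integral_pushforward _ _ _ _ _ _ mopp lebesgue_measure A
  (fun x => (normal_pdf 0 s x)%:E) mA.
transitivity (\int[pushforward lebesgue_measure opp]_(x in A)
   (normal_pdf 0 s x)%:E)%E.
  by apply: eq_measure_integral => B mB _; exact/esym/lebesgue_measureN.
rewrite E/=; first last.
- by move=> x _; rewrite lee_fin normal_pdf_ge0.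
- by apply/measurable_EFinP/measurable_funTS; exact: measurable_normal_pdf.
apply: eq_integral => x _; rewrite !normal_pdfE ?gt_eqF//.
by rewrite /normal_fun/opp !subr0 sqrrN.
Qed.

End Means.

(** * Affine images of a law and their Wasserstein distance *)

Section AffineLaw.
Context {R : realType}.
Implicit Type m : law R.

Definition affine (a b : R) : measurableTypeR R -> measurableTypeR R :=
  fun x => a * x + b.

Lemma measurable_affine a b : measurable_fun setT (affine a b).
Proof.
apply: (@measurable_funD _ _ R); last exact: measurable_cst.
apply: (@measurable_funM _ _ R); first exact: measurable_cst.
exact: measurable_id.
Qed.

HB.instance Definition _ a b := isMeasurableFun.Build _ _ _ _
  (affine a b) (measurable_affine a b).

Definition affine_law m a b : law R := distribution m (affine a b).

Lemma mean_affine_law m a b : P2 m -> mean (affine_law m a b) = a * mean m + b.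
Proof.
move=> m2; rewrite -Rintegral_affine// /mean /Rintegral; congr fine.
rewrite integral_distribution//.
rewrite /comp/affine/=.
under [X in integrable _ _ X]eq_fun do rewrite EFinD EFinM.
apply: integrableD => //; last exact: finite_measure_integrable_cst.
by apply: integrableZl => //; exact: P2_integrable.
Qed.

(** From (u + v) ^ 2 <= 2 u ^ 2 + 2 v ^ 2: the bound tends to 0 with a and b. *)
Lemma affine_moment_le m a b : P2 m ->
  (\int[m]_x ((a * (x : R) + b) ^+ 2)%:E <=
   (2 * a ^+ 2 * fine (second_moment m) + 2 * b ^+ 2)%:E)%E.
Proof.
move=> m2; have m20 : (0 <= second_moment m)%E.
  by apply: integral_ge0 => x _; rewrite lee_fin sqr_ge0.
have msq : measurable_fun setT (fun x : measurableTypeR R => ((x : R) ^+ 2)%:E).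
  by apply/measurable_EFinP; exact: exprn_measurable.
apply: (@le_trans _ _
  (\int[m]_x ((2 * a ^+ 2)%:E * ((x : R) ^+ 2)%:E + (2 * b ^+ 2)%:E))%E).
  apply: ge0_le_integral => //.
  - by move=> x _; rewrite lee_fin sqr_ge0.
  - apply/measurable_EFinP/measurable_funX.
    exact: (measurable_affine a b).
  - apply: emeasurable_funD => //.
    by apply: emeasurable_funM.
  - move=> x _; rewrite -EFinM -EFinD lee_fin.
    have := sqr_ge0 (a * (x : R) - b); rewrite -subr_ge0.
    lra.
have C0 : 0 <= 2 * a ^+ 2 by rewrite mulr_ge0// sqr_ge0.
have D0 : 0 <= 2 * b ^+ 2 by rewrite mulr_ge0// sqr_ge0.
rewrite ge0_integralD//; first last.
- by apply: emeasurable_funM.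
- by move=> x _; rewrite mule_ge0// lee_fin// sqr_ge0.
rewrite integral_cst//= probability_setT mule1 ge0_integralZl//; last first.
  by move=> x _; rewrite lee_fin sqr_ge0.
rewrite -/(second_moment m) -[X in (_ * X + _)%E]fineK.
  by rewrite EFinD EFinM.
by rewrite ge0_fin_numE//; apply/P2E.
Qed.

Lemma affine_law_P2 m a b : P2 m -> P2 (affine_law m a b).
Proof.
move=> m2; apply/P2E; rewrite /second_moment ge0_integral_distribution//.
- by apply: (le_lt_trans (affine_moment_le a b m2)); rewrite ltry.
- by apply/measurable_EFinP; exact: exprn_measurable.
- by move=> x; rewrite lee_fin sqr_ge0.
Qed.

Definition affine_pair (a b a' b' : R) :
    measurableTypeR R -> (measurableTypeR R * measurableTypeR R)%type :=
  fun x => (affine a b x, affine a' b' x).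

Lemma measurable_affine_pair a b a' b' :
  measurable_fun setT (affine_pair a b a' b').
Proof. by apply: measurable_fun_pair; exact: measurable_affine. Qed.

HB.instance Definition _ a b a' b' := isMeasurableFun.Build _ _ _ _
  (affine_pair a b a' b') (measurable_affine_pair a b a' b').

(** The coupling is the law of (a X + b, a' X + b') with X of law m. *)
Lemma W2_affine_law_le m a b a' b' : P2 m ->
  (W2 (affine_law m a b) (affine_law m a' b') <=
   (Num.sqrt (2 * (a - a') ^+ 2 * fine (second_moment m)
              + 2 * (b - b') ^+ 2))%:E)%E.
Proof.
move=> m2; set E := (X in Num.sqrt X).
have E0 : 0 <= E.
  have D0 c : 0 <= 2 * c ^+ 2 :> R by rewrite mulr_ge0// sqr_ge0.
  apply: addr_ge0 => //; apply: mulr_ge0 => //; apply: fine_ge0.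
  by apply: integral_ge0 => x _; rewrite lee_fin sqr_ge0.
rewrite /W2 -powR12_sqrt// -poweR_EFin.
set I := ereal_inf _.
have I0 : (0 <= I)%E.
  apply: le_ereal_inf_tmp => _ [pi _ <-]; apply: integral_ge0 => z _.
  by rewrite lee_fin sqr_ge0.
apply: gt0_ler_poweR; rewrite ?invr_ge0 ?in_itv/= ?leey ?andbT ?lee_fin//.
apply: (@le_trans _ _ (\int[m]_x (((a - a') * (x : R) + (b - b')) ^+ 2)%:E)%E);
  last exact: affine_moment_le.
pose pi : probability _ R := distribution m (affine_pair a b a' b').
have <- : (\int[pi]_z (((z.1 : R) - z.2) ^+ 2)%:E =
    \int[m]_x (((a - a') * (x : R) + (b - b')) ^+ 2)%:E)%E.
  rewrite ge0_integral_distribution//.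
  - by apply: eq_integral => x _ /=; rewrite /affine; congr (_%:E); ring.
  - apply/measurable_EFinP/measurable_funX; apply: (@measurable_funB _ _ R).
      exact: measurable_fst.
    exact: measurable_snd.
  - by move=> z; rewrite lee_fin sqr_ge0.
by apply: ereal_inf_lbound; exists pi.
Qed.

Lemma affine_flow m (T : R) (a b : R -> R) : P2 m ->
  continuous a -> continuous b -> P2_flow T (fun t => affine_law m (a t) (b t)).
Proof.
move=> m2 ca cb; split=> t _; first exact: affine_law_P2.
pose F s : R := 2 * (a s - a t) ^+ 2 * fine (second_moment m)
  + 2 * (b s - b t) ^+ 2.
pose E : R -> R := @Num.sqrt R \o F.
have sqr_cvg (u : R -> R) : continuous u ->
    (u s - u t) ^+ 2 @[s --> t] --> (u t - u t) ^+ 2.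
  move=> cu; apply: (@continuous_cvg _ _ _ _ _ (fun s => u s - u t)
    (fun x : R => x ^+ 2)); first exact: sqr_continuous.
  by apply: cvgB; [exact: cu|exact: cvg_cst].
have cE : E s @[s --> t] --> E t.
  apply: (@continuous_cvg _ _ _ _ _ F (@Num.sqrt R)).
    exact: sqrt_continuous.
  apply: cvgD; apply: cvgM; try exact: cvg_cst.
    by apply: cvgM; [exact: cvg_cst|exact: sqr_cvg].
  exact: sqr_cvg.
have Et : E t = 0 by rewrite /E/= /F !subrr expr0n/= mulr0 mul0r addr0 sqrtr0.
have {cE} E0 : E s @[s --> within `[0, T] (nbhs t)] --> (0 : R).
  by rewrite -Et; exact: cvg_within_filter.
apply: (@squeeze_cvge _ _ _ _ (cst 0%E) _ (fun s => (E s)%:E)).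
- by apply: nearW => s; rewrite poweR_ge0/= W2_affine_law_le.
- exact: cvg_cst.
- by apply: cvg_EFin; [exact: nearW|exact: E0].
Qed.

End AffineLaw.

(** * Continuity equation for laws carried by straight lines *)

Section ChainRule.
Context {R : realType}.
Variable phi : R^o * R^o -> R^o.

Lemma is_derive_of_cvg (f : R -> R) (x l : R) :
  h^-1 * (f (h + x) - f x) @[h --> 0^'] --> l ->
  is_derive (x : R^o) (1 : R^o) (f : R^o -> R^o) l.
Proof.
move=> fl.
have {}fl : h^-1 *: (((f : R^o -> R^o) \o shift (x : R^o)) (h *: (1 : R^o))
    - f x) @[h --> 0^'] --> l.
  under eq_fun => h do rewrite /= /GRing.scale/= mulr1.
  exact: fl.
apply: DeriveDef; first exact: cvgP fl.
exact: cvg_lim fl.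
Qed.

Lemma cvg_of_is_derive (f : R -> R) (x l : R) :
  is_derive (x : R^o) (1 : R^o) (f : R^o -> R^o) l ->
  h^-1 * (f (h + x) - f x) @[h --> 0^'] --> l.
Proof.
move=> [/cvg_ex[k fk]]; rewrite /derive (cvg_lim _ fk)// => <-.
apply: cvg_trans fk; apply: near_eq_cvg; apply: nearW => h /=.
by rewrite /GRing.scale/= mulr1.
Qed.

Lemma is_derive_slice1 (t y : R) : derivable phi (t, y) (1, 0) ->
  is_derive (t : R^o) 1 (fun s => phi (s, y)) ('D_(1, 0) phi (t, y)).
Proof.
move=> d; apply: is_derive_of_cvg.
move: d => /cvg_ex[l dl]; rewrite /derive (cvg_lim _ dl)//.
apply: cvg_trans dl; apply: near_eq_cvg; apply: nearW => h /=.
rewrite /GRing.scale/=; congr (_ * (phi _ - _)).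
by rewrite -[LHS]/(h * 1 + t, h * 0 + y) mulr1 mulr0 add0r.
Qed.

Lemma is_derive_slice2 (t y : R) : derivable phi (t, y) (0, 1) ->
  is_derive (y : R^o) 1 (fun s => phi (t, s)) ('D_(0, 1) phi (t, y)).
Proof.
move=> d; apply: is_derive_of_cvg.
move: d => /cvg_ex[l dl]; rewrite /derive (cvg_lim _ dl)//.
apply: cvg_trans dl; apply: near_eq_cvg; apply: nearW => h /=.
rewrite /GRing.scale/=; congr (_ * (phi _ - _)).
by rewrite -[LHS]/(h * 0 + t, h * 1 + y) mulr1 mulr0 add0r.
Qed.

Hypothesis d1 : forall z, derivable phi z (1, 0).
Hypothesis d2 : forall z, derivable phi z (0, 1).
Hypothesis c1 : continuous (fun z => 'D_(1, 0) phi z).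

Lemma slice1_MVT (t h y : R) : exists s : R, `|s - t| <= `|h| /\
  phi (h + t, y) - phi (t, y) = 'D_(1, 0) phi (s, y) * h.
Proof.
have D s : is_derive (s : R^o) 1 (fun s => phi (s, y)) ('D_(1, 0) phi (s, y)).
  exact: is_derive_slice1.
have C u v : {within `[u, v], continuous (fun s => phi (s, y) : R)}.
  apply: derivable_within_continuous => s _.
  by have [] := D s.
have [h0|h0] := leP 0 h.
  have [s] := @MVT_segment R (fun s => phi (s, y)) _ t (h + t)
    (ler_wpDl h0 (lexx t)) (fun s _ => D s) (C _ _).
  rewrite in_itv/= => /andP[ts st] ->; exists s; rewrite addrK; split=> //.
  by rewrite ger0_norm ?subr_ge0// ger0_norm// lerBlDr.
have [|s] := @MVT_segment R (fun s => phi (s, y)) _ (h + t) t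
    _ (fun s _ => D s) (C _ _); first by rewrite gerDr ltW.
rewrite in_itv/= => /andP[ts st] E; exists s; split.
  rewrite ler0_norm ?subr_le0// ltr0_norm// opprB lerBlDr addrC -lerBlDr opprK.
  by rewrite addrC.
by apply: oppr_inj; rewrite opprB E; ring.
Qed.

(** Continuity of the time derivative is enough: the increment of phi along the
    line splits into an increment in time, which the mean value theorem writes
    as the time derivative at an intermediate time s h, and an increment in
    space at the fixed time t. *)
Lemma is_derive_line (x a t : R) :
  is_derive (t : R^o) 1 (fun s : R => phi (s, x + s * a))
    ('D_(1, 0) phi (t, x + t * a) + a * 'D_(0, 1) phi (t, x + t * a)).
Proof.
apply: is_derive_of_cvg.
have /choice[s Hs] := fun h => slice1_MVT t h (x + (h + t) * a).
have -> : (fun h => h^-1 * (phi (h + t, x + (h + t) * a) - phi (t, x + t * a)))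
  = (fun h => h^-1 * ('D_(1, 0) phi (s h, x + (h + t) * a) * h)
       + h^-1 * (phi (t, x + (h + t) * a) - phi (t, x + t * a))).
  by apply/funext => h; have [_ <-] := Hs h; rewrite -mulrDr addrA subrK.
apply: cvgD; last first.
  have ld : is_derive (t : R^o) 1 (fun s : R => phi (t, x + s * a) : R)
      (a * 'D_(0, 1) phi (t, x + t * a)).
    have dl : is_derive (t : R^o) 1 (fun s : R^o => x + s * a : R^o) a.
      by apply: is_derive_eq; rewrite /GRing.scale/=; ring.
    have := @is_derive1_comp R (fun y => phi (t, y)) (fun s => x + s * a) t _ _
     (@is_derive_slice2 t (x + t * a) (@d2 _)) dl.
    by rewrite /GRing.scale/= mulrC.
  exact: cvg_of_is_derive ld.
have key : 'D_(1, 0) phi (s h, x + (h + t) * a) @[h --> 0^'] -->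
    'D_(1, 0) phi (t, x + t * a).
  apply: (@continuous_cvg _ _ _ _ _ (fun h => (s h, x + (h + t) * a))
    (fun z => 'D_(1, 0) phi z)); first exact: c1.
  apply: (@cvg_pair _ _ _ _ (nbhs (t : R^o)) (nbhs (x + t * a : R^o))) => /=.
    apply/cvgrPdist_le => e e0; near=> h.
    rewrite distrC (le_trans (Hs h).1)//.
    by near: h; apply: dnbhs0_le.
  apply: cvg_within_filter.
  rewrite -[in X in _ --> X](add0r t).
  apply: cvgD; first exact: cvg_cst.
  apply: cvgM; last exact: cvg_cst.
  by apply: cvgD; [exact: cvg_id|exact: cvg_cst].
apply: cvg_trans key; apply: near_eq_cvg; near=> h.
rewrite mulrCA mulVf ?mulr1//.
by near: h; exact: nbhs_dnbhs_neq.
Unshelve. all: by end_near. Qed.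

End ChainRule.

Section CompactSupport.
Context {R : realType}.
Implicit Types (f : R^o * R^o -> R^o) (K : set (R^o * R^o)).

Lemma compact_support_bounded f K : compact K -> continuous f ->
  (forall z, ~ K z -> f z = 0) -> exists2 M : R, 0 <= M & forall z, `|f z| <= M.
Proof.
move=> cK cf f0.
have : compact (f @` K).
  by apply: continuous_compact => //; exact: continuous_subspaceT.
move=> /compact_bounded; rewrite /bounded_set => /pinfty_ex_gt0[M M0 HM].
exists M; first exact: ltW.
move=> z; have [Kz|nKz] := pselect (K z); last by rewrite f0// normr0 ltW.
by apply: HM; exists z.
Qed.

Lemma derive_off_support f K v z : compact K ->
  (forall z, ~ K z -> f z = 0) -> ~ K z -> 'D_v f z = 0.
Proof.
move=> cK f0 nKz.
rewrite (@near_eq_derive _ _ _ f (cst 0)) ?derive_cst//.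
have oK : open (~` K).
  by rewrite openC; apply: compact_closed => //; exact: norm_hausdorff.
by apply: filterS (open_nbhs_nbhs (conj oK nKz)) => w; exact: f0.
Qed.

End CompactSupport.

Section ContinuityEquation.
Context {R : realType}.
Variables (m : law R) (a c : R).
Hypothesis m2 : P2 m.
Variable phi : R^o * R^o -> R^o.

(* psi t x = phi (t, X_t x) along the line X_t x = x + t * (a * x + c), and dpsi
   is its time derivative *)
Let psi (t x : R) : R := phi (t, x + t * (a * x + c)).
Let dpsi (t x : R) : R := partial false phi (t, x + t * (a * x + c)) +
  (a * x + c) * partial true phi (t, x + t * (a * x + c)).

Hypothesis d1 : forall z, derivable phi z (1, 0).
Hypothesis d2 : forall z, derivable phi z (0, 1).
Hypothesis c0 : continuous phi.
Hypothesis c1 : continuous (partial false phi).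
Hypothesis c2 : continuous (partial true phi).
Variable M : R.
Hypothesis M0 : forall z, `|phi z| <= M.
Hypothesis M1 : forall z, `|partial false phi z| <= M.
Hypothesis M2 : forall z, `|partial true phi z| <= M.

Let is_derive_psi x t :
  is_derive (t : R^o) 1 (psi ^~ x : R^o -> R^o) (dpsi t x).
Proof. exact: is_derive_line. Qed.

Let dom (x : R) : R := M * (1 + `|a * x + c|).

Let M_ge0 : 0 <= M. Proof. exact: le_trans (normr_ge0 _) (M0 (0, 0)). Qed.

Let dom_ge0 x : 0 <= dom x.
Proof. by rewrite mulr_ge0// addr_ge0. Qed.

Let integrable_dom : m.-integrable setT (fun x => (dom x)%:E).
Proof.
have i1 : m.-integrable setT (fun x => (a * (x : R) + c)%:E).
  under [X in integrable _ _ X]eq_fun do rewrite EFinD EFinM.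
  apply: integrableD => //; last exact: finite_measure_integrable_cst.
  by apply: integrableZl => //; exact: P2_integrable.
rewrite /dom; under [X in integrable _ _ X]eq_fun do rewrite EFinM EFinD.
apply: integrableZl => //; apply: integrableD => //.
  exact: finite_measure_integrable_cst.
exact: (integrable_abse i1).
Qed.

Let continuous_traj t :
  continuous (fun x : R => (t, x + t * (a * x + c)) : R^o * R^o).
Proof.
move=> x; apply: (@cvg_pair _ _ _ _ (nbhs (t : R^o))
  (nbhs (x + t * (a * x + c) : R^o))).
  exact: cvg_cst.
apply: cvgD; first exact: cvg_id.
apply: cvgM; first exact: cvg_cst.
apply: cvgD; last exact: cvg_cst.
by apply: cvgM; [exact: cvg_cst|exact: cvg_id].
Qed.

Let continuous_time x :
  continuous (fun t : R => (t, x + t * (a * x + c)) : R^o * R^o).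
Proof.
move=> t; apply: (@cvg_pair _ _ _ _ (nbhs (t : R^o))
  (nbhs (x + t * (a * x + c) : R^o))).
  exact: cvg_id.
apply: cvgD; first exact: cvg_cst.
by apply: cvgM; [exact: cvg_id|exact: cvg_cst].
Qed.

Let continuous_comp_traj (f : R^o * R^o -> R^o) t : continuous f ->
  continuous (fun x : R => f (t, x + t * (a * x + c)) : R).
Proof.
move=> cf x; apply: (@continuous_cvg _ _ _ _ _
  (fun x : R => (t, x + t * (a * x + c)) : R^o * R^o) f).
  exact: cf.
exact: continuous_traj.
Qed.

Let continuous_comp_time (f : R^o * R^o -> R^o) x : continuous f ->
  continuous (fun t : R => f (t, x + t * (a * x + c)) : R).
Proof.
move=> cf t; apply: (@continuous_cvg _ _ _ _ _
  (fun t : R => (t, x + t * (a * x + c)) : R^o * R^o) f).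
  exact: cf.
exact: continuous_time.
Qed.

Let psi_le t x : `|psi t x| <= dom x.
Proof. by rewrite (le_trans (M0 _))// /dom ler_peMr// lerDl. Qed.

Let dpsi_le t x : `|dpsi t x| <= dom x.
Proof.
rewrite (le_trans (ler_normD _ _))// /dom [leRHS]mulrDr mulr1 lerD//.
by rewrite normrM mulrC ler_wpM2r//; exact: M2.
Qed.

Let measurable_psi t : measurable_fun setT (psi t).
Proof. by apply: continuous_measurable_fun; exact: continuous_comp_traj. Qed.

Let measurable_dpsi t : measurable_fun setT (dpsi t).
Proof.
apply: measurable_funD.
  by apply: continuous_measurable_fun; exact: continuous_comp_traj.
apply: measurable_funM; first exact: (measurable_affine a c).
by apply: continuous_measurable_fun; exact: continuous_comp_traj.
Qed.

Let integrable_psi t : m.-integrable setT (fun x => (psi t x)%:E).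
Proof.
apply: (le_integrable _ _ _ integrable_dom) => //.
  by apply/measurable_EFinP; exact: measurable_psi.
by move=> x _; rewrite !abse_EFin lee_fin (ger0_norm (dom_ge0 x)).
Qed.

Lemma integrable_material_derivative t :
  m.-integrable setT (fun x => (dpsi t x)%:E).
Proof.
apply: (le_integrable _ _ _ integrable_dom) => //.
  by apply/measurable_EFinP; exact: measurable_dpsi.
by move=> x _; rewrite !abse_EFin lee_fin (ger0_norm (dom_ge0 x)).
Qed.

Let F (t : R) : R := \int[m]_x psi t x.
Let dF (t : R) : R := \int[m]_x dpsi t x.

Let partial1_psi t x : partial1of2 psi t x = dpsi t x.
Proof. by rewrite partial1of2E; have [_ ->] := is_derive_psi x t. Qed.

Let in_window (t : R) : t \in `]t - 1, t + 1[%classic.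
Proof. by rewrite inE/= in_itv/= ltrDl ltrBlDr ltrDl ltr01. Qed.

Let is_derive_F t : is_derive (t : R^o) 1 (F : R^o -> R^o) (dF t).
Proof.
have It := set_mem (in_window t).
have df s x : derivable (psi ^~ x) s 1 by have [] := is_derive_psi x s.
have G s x : `|partial1of2 psi s x| <= dom x by rewrite partial1_psi.
apply: DeriveDef.
  exact: (@derivable_under_integral _ _ _ m psi setT measurableT t (t - 1)
    (t + 1) It (fun s _ => integrable_psi s) (fun s x _ _ => df s x) dom dom_ge0
    integrable_dom (fun s x _ _ => G s x)).
rewrite -derive1E.
rewrite (@differentiation_under_integral _ _ _ m psi setT measurableT t (t - 1)
    (t + 1) It (fun s _ => integrable_psi s) (fun s x _ _ => df s x) dom dom_ge0
    integrable_dom (fun s x _ _ => G s x)).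
by apply: eq_Rintegral => x _; exact: partial1_psi.
Qed.

Let continuous_dF : continuous dF.
Proof.
move=> t.
apply: (@continuity_under_integral _ _ _ m dpsi setT measurableT (t - 1) (t + 1)
  (fun s _ => integrable_material_derivative s) _ dom integrable_dom _ t
  (in_window t)).
  apply: aeW => x _ s _; apply: cvgD; first exact: continuous_comp_time.
  by apply: cvgM; [exact: cvg_cst|exact: continuous_comp_time].
by move=> s _; apply: aeW => x _.
Qed.

(** Differentiation under the integral sign in x turns the left-hand side into
    the integral over ]0, T[ of the continuous derivative of
    t |-> \int[m]_x psi t x. *)
Lemma integral_material_derivative (T : R) : 0 < T ->
  \int[lebesgue_measure]_(t in `]0, T[) (\int[m]_x dpsi t x) =
  \int[m]_x psi T x - \int[m]_x psi 0 x.
Proof.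
move=> T0; rewrite -/(F T) -/(F 0).
have dFF : continuous F.
  move=> t; apply: differentiable_continuous; apply/derivable1_diffP.
  by have [] := is_derive_F t.
have E : (\int[lebesgue_measure]_(x in `[0%R, T]) (dF x)%:E =
    (F T)%:E - (F 0)%:E)%E.
  apply: continuous_FTC2 => //.
  - exact: continuous_subspaceT.
  - split.
    + by move=> t _; have [] := is_derive_F t.
    + by apply: cvg_at_right_filter; exact: dFF.
    + by apply: cvg_at_left_filter; exact: dFF.
  - by move=> t _; rewrite derive1E; have [_ ->] := is_derive_F t.
rewrite -/(dF) /Rintegral integral_itv_bndo_bndc.
  rewrite integral_itv_obnd_cbnd.
    by rewrite E.
  by apply/measurable_EFinP/measurable_funTS; exact: continuous_measurable_fun.
by apply/measurable_EFinP/measurable_funTS; exact: continuous_measurable_fun.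
Qed.

End ContinuityEquation.

(** The hypothesis on b says that b t is the velocity of the lines
    X_t x = x + t * (a * x + c), which carry m to the law at time t. For a test
    function phi, the weak formulation is then the integral of the time
    derivative of phi (t, X_t x), whose boundary terms vanish because the
    support of phi lies in ]0, T[. *)
Lemma affine_law_continuity_equation {R : realType} (T a c : R) (m : law R)
    (b : R -> R -> R) : 0 < T -> P2 m ->
  (forall t, measurable_fun (setT : set (measurableTypeR R))
    (b t : measurableTypeR R -> R)) ->
  (forall t x, t \in `]0, T[ -> b t (x + t * (a * x + c)) = a * x + c) ->
  continuity_equation T (fun t => affine_law m (1 + t * a) (t * c)) b.
Proof.
move=> T0 m2 mb bE phi [sphi [K [cK KT phi0]]].
have c0 : continuous phi by have [] := sphi [::].
have d1 z : derivable phi z (1, 0) by have [_ /(_ false)] := sphi [::].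
have d2 z : derivable phi z (0, 1) by have [_ /(_ true)] := sphi [::].
have c1 : continuous (partial false phi) by have [] := sphi [:: false].
have c2 : continuous (partial true phi) by have [] := sphi [:: true].
have [A A0 HA] := compact_support_bounded cK c0 phi0.
have [B B0 HB] := compact_support_bounded cK c1
  (fun z => @derive_off_support _ phi K _ z cK phi0).
have [C C0 HC] := compact_support_bounded cK c2
  (fun z => @derive_off_support _ phi K _ z cK phi0).
pose M := A + B + C.
have HM : [/\ A <= M, B <= M & C <= M] by rewrite /M; split; lra.
case: HM => AM BM CM.
have E := @integral_material_derivative R m a c m2 phi d1 d2 c0 c1 c2 M
  (fun z => le_trans (HA z) AM) (fun z => le_trans (HB z) BM)
  (fun z => le_trans (HC z) CM) T T0.
have phi_off t : ~ (0 < t < T) -> \int[m]_x phi (t, x + t * (a * x + c)) = 0.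
  move=> tT; rewrite -[RHS](mul0r (fine (m setT))) -Rintegral_cst//.
  by apply: eq_Rintegral => x _; apply: phi0 => /KT[]/=; rewrite in_itv.
rewrite phi_off in E; last by rewrite ltxx andbF.
rewrite phi_off in E; last by rewrite ltxx.
rewrite subr0 in E.
rewrite -[RHS]E; apply: eq_Rintegral => t; rewrite inE/= => tT.
have affineE x : affine (1 + t * a) (t * c) x = x + t * (a * x + c).
  by rewrite /affine; ring.
pose G (x : measurableTypeR R) : R :=
  partial false phi (t, x) + b t x * partial true phi (t, x).
have cpair (f : R^o * R^o -> R^o) : continuous f ->
    measurable_fun (setT : set (measurableTypeR R)) (fun x : R => f (t, x) : R).
  move=> cf; apply: continuous_measurable_fun => x.
  apply: (@continuous_cvg _ _ _ _ _ (fun x : R => (t, x) : R^o * R^o) f).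
    exact: cf.
  by apply: (@cvg_pair _ _ _ _ (nbhs (t : R^o)) (nbhs (x : R^o)));
    [exact: cvg_cst|exact: cvg_id].
have mG : measurable_fun setT G.
  apply: (@measurable_funD _ _ R); first exact: cpair.
  by apply: (@measurable_funM _ _ R); [exact: mb|exact: cpair].
have GE x : G (affine (1 + t * a) (t * c) x) =
    partial false phi (t, x + t * (a * x + c)) +
    (a * x + c) * partial true phi (t, x + t * (a * x + c)).
  by rewrite /G affineE bE.
rewrite /Rintegral; congr fine.
rewrite -[LHS]/(\int[distribution m (affine (1 + t * a) (t * c))]_x (G x)%:E)%E.
rewrite integral_distribution.
- by apply: eq_integral => x _; rewrite /= GE.
- exact/measurable_EFinP.
- rewrite (_ : _ \o _ = (fun x => (partial false phi (t, x + t * (a * x + c)) +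
    (a * x + c) * partial true phi (t, x + t * (a * x + c)))%:E));
    last by apply/funext => x; rewrite /= GE.
  exact: (@integrable_material_derivative R m a c m2 phi c1 c2 M
    (fun z => le_trans (HA z) AM) (fun z => le_trans (HB z) BM)
    (fun z => le_trans (HC z) CM)).
Qed.

(** * The quadratic value function *)

Section Value.
Context {R : realType}.
Variables (T gamma kappa rho c : R).

(** The terminal position of the optimal trajectory from (t, x), shifted by the
    mean term rho * T * c of the terminal cost, is this quantity multiplied by
    (gamma + 1) / (gamma + 1 + T - t). *)
Definition offset (t x : R) : R :=
  x + rho * T * c - (T - t) * (kappa * c / (gamma + 1)).

(** Hopf-Lax formula for the running cost with mean control c and the terminal
    cost y |-> (y + rho * T * c) ^ 2 / 2. *)
Definition value (t x : R) : R :=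
  (gamma + 1) / 2 * offset t x ^+ 2 * (gamma + 1 + T - t)^-1
  + gamma * (kappa * c) ^+ 2 / (2 * (gamma + 1)) * (T - t).

Definition gradient (t x : R) : R :=
  (gamma + 1) * offset t x * (gamma + 1 + T - t)^-1.

(** [H] at a control law of mean c. *)
Definition hamiltonian (p : R) : R :=
  p ^+ 2 / (2 * (gamma + 1)) + kappa * p / (gamma + 1) * c
  - gamma * kappa ^+ 2 / (2 * (gamma + 1)) * c ^+ 2.

(** This covers the singular time t = gamma + 1 + T: the inverse is 0 there by
    convention, so that the value is constant in x and its gradient is 0. *)
Lemma is_derive_value_x (t x : R) : is_derive x 1 (value t) (gradient t x).
Proof.
rewrite /value /offset; apply: is_derive_eq.
rewrite /gradient /offset /GRing.scale/=.
by set k := (_ - t)^-1; set d := kappa * c / _; field.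
Qed.

Lemma derive1_value (t x : R) : derive1 (value t) x = gradient t x.
Proof. by rewrite derive1E; have [_ ->] := is_derive_value_x t x. Qed.

Hypothesis gamma_gt0 : 0 < gamma.

Lemma is_derive_value_t (t x : R) : t < T ->
  is_derive t 1 (value ^~ x) (hamiltonian (gradient t x)).
Proof.
move=> tT; have g1 : gamma + 1 != 0 by rewrite gt_eqF// addr_gt0.
have d0 : gamma + 1 + T - t != 0.
  by rewrite gt_eqF// -addrA addr_gt0 ?subr_gt0// addr_gt0.
rewrite /value /offset; apply: is_derive_eq.
rewrite /hamiltonian /gradient /offset /GRing.scale/=; field.
by rewrite g1 d0.
Qed.

Lemma derive1_H (nu : law R) p : derive1 (H gamma kappa ^~ nu) p
  = (p + kappa * mean nu) / (gamma + 1).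
Proof.
have -> : (H gamma kappa ^~ nu) = (fun p => p ^+ 2 / (2 * (gamma + 1))
    + kappa * p / (gamma + 1) * mean nu
    - gamma * kappa ^+ 2 / (2 * (gamma + 1)) * mean nu ^+ 2).
  by apply/funext => q; have [-> _] := hamiltonianE kappa q nu gamma_gt0.
have g1 : gamma + 1 != 0 by rewrite gt_eqF// addr_gt0.
rewrite derive1E.
apply: derive_val.
by apply: is_derive_eq; rewrite /GRing.scale/=; field.
Qed.

Lemma continuous_offset : continuous (fun z : R * R => offset z.1 z.2).
Proof.
move=> z; rewrite /offset.
apply: cvgB; first apply: cvgD; try exact: cvg_cst.
  exact: cvg_snd.
apply: cvgM; last exact: cvg_cst.
by apply: cvgB; [exact: cvg_cst|exact: cvg_fst].
Qed.

Lemma continuous_den_inv z : z \in `[0, T] `*` (setT : set R) ->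
  (gamma + 1 + T - u.1)^-1 @[u --> z] --> (gamma + 1 + T - z.1)^-1.
Proof.
rewrite inE/= in_itv/= => -[/andP[_ zT] _].
apply: cvgV; first by rewrite gt_eqF// -addrA ltr_wpDr ?subr_ge0// addr_gt0.
by apply: cvgB; [exact: cvg_cst|exact: cvg_fst].
Qed.

Lemma continuous_value :
  {within `[0, T] `*` (setT : set R),
    continuous (fun z : R * R => value z.1 z.2)}.
Proof.
apply: continuous_in_subspaceT => z zD.
apply: cvgD; apply: cvgM; try exact: cvg_cst.
- apply: cvgM; first exact: cvg_cst.
  apply: (@continuous_cvg _ _ _ _ _ (fun z : R * R => offset z.1 z.2)
    (fun x : R => x ^+ 2)); first exact: sqr_continuous.
  exact: continuous_offset.
- exact: continuous_den_inv.
- by apply: cvgB; [exact: cvg_cst|exact: cvg_fst].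
Qed.

Lemma continuous_gradient z : z \in `[0, T] `*` (setT : set R) ->
  gradient u.1 u.2 @[u --> z] --> gradient z.1 z.2.
Proof.
move=> zD; apply: cvgM; last exact: continuous_den_inv.
apply: cvgM; first exact: cvg_cst.
exact: continuous_offset.
Qed.

Lemma continuous_hamiltonian : continuous hamiltonian.
Proof.
move=> p; rewrite /hamiltonian.
apply: cvgB; last exact: cvg_cst.
apply: cvgD; apply: cvgM; try exact: cvg_cst.
  exact: sqr_continuous.
apply: cvgM; last exact: cvg_cst.
by apply: cvgM; [exact: cvg_cst|exact: cvg_id].
Qed.

Lemma value_C1 : C1 T value.
Proof.
split.
- exact: continuous_value.
- by move=> t x _; have [] := is_derive_value_x t x.
- rewrite (_ : (fun z => _) = (fun z : R * R => gradient z.1 z.2)); last first.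
    by apply/funext => z; exact: derive1_value.
  by apply: continuous_in_subspaceT => z zD; exact: continuous_gradient.
exists (fun z => hamiltonian (gradient z.1 z.2)); split.
  apply: continuous_in_subspaceT => z zD.
  apply: (@continuous_cvg _ _ _ _ _ (fun z : R * R => gradient z.1 z.2)).
    exact: continuous_hamiltonian.
  exact: continuous_gradient.
by move=> t x; rewrite in_itv/= => /andP[_ tT]; exact: is_derive_value_t.
Qed.

Lemma value_HJ (nu : law R) t x : t < T -> mean nu = c ->
  - derive1 (value ^~ x) t + H gamma kappa (derive1 (value t) x) nu = 0.
Proof.
move=> tT nuc; rewrite derive1_value derive1E.
have [_ ->] := is_derive_value_t x tT.
by have [-> _] := hamiltonianE kappa (gradient t x) nu gamma_gt0;
  rewrite nuc addNr.
Qed.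

Lemma value_terminal (m : law R) x : mean m = T * c ->
  value T x = g rho x m.
Proof.
move=> mTc; rewrite /value /g /offset mTc.
have g1 : gamma + 1 != 0 by rewrite gt_eqF// addr_gt0.
by rewrite addrK subrr; field.
Qed.

End Value.

(** * The family of solutions *)

Section Solutions.
Context {R : realType}.
Variables (T gamma kappa rho s0 : R).
Hypotheses (hT : 0 < T) (hgamma : 0 < gamma) (hrho : rho != 0) (hs0 : 0 < s0)
  (hres : 1 + kappa + gamma + T * (1 + rho) = 0).

Definition initial_law : law R := gaussian (s0 * Num.sqrt 2)^-1.

(** Dispersion rate of the velocities: the agent starting at x moves with
    velocity c + slope * x. *)
Definition slope : R := - (gamma + 1 + T)^-1.

Definition state_flow (c t : R) : law R :=
  affine_law initial_law (1 + t * slope) (t * c).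

(** Velocities are constant along trajectories, hence the law of the controls
    is constant in time. *)
Definition control_flow (c t : R) : law R := affine_law initial_law slope c.

Definition drift (c t x : R) : R :=
  - DpH gamma kappa (derive1 (value T gamma kappa rho c t) x)
      (control_flow c t).

Let sigma_gt0 : 0 < (s0 * Num.sqrt 2)^-1.
Proof. by rewrite invr_gt0 mulr_gt0// sqrtr_gt0. Qed.

Let P2_initial : P2 initial_law.
Proof. exact: gaussian_P2. Qed.

Lemma mean_control_flow c t : mean (control_flow c t) = c.
Proof. by rewrite mean_affine_law// gaussian_mean// mulr0 add0r. Qed.

Lemma mean_state_flow c t : mean (state_flow c t) = t * c.
Proof. by rewrite mean_affine_law// gaussian_mean// mulr0 add0r. Qed.

Lemma driftE c t x : drift c t x =
  - (gradient T gamma kappa rho c t x + kappa * c) / (gamma + 1).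
Proof.
by rewrite /drift /DpH derive1_H// derive1_value mean_control_flow mulNr.
Qed.

(** The x-terms agree for any parameters; the constant terms agree precisely
    because rho * T = - (1 + kappa + gamma + T). *)
Lemma drift_along_line c t x : t <= T ->
  drift c t (x + t * (slope * x + c)) = slope * x + c.
Proof.
move=> tT; rewrite driftE /gradient /offset /slope.
have g1 : gamma + 1 != 0 by rewrite gt_eqF// addr_gt0.
have gT : gamma + 1 + T != 0 by rewrite gt_eqF// !addr_gt0.
have d0 : gamma + 1 + T - t != 0.
  by rewrite gt_eqF// -addrA ltr_wpDr ?subr_ge0// addr_gt0.
have -> : rho * T * c = - (1 + kappa + gamma + T) * c.
  by rewrite -[LHS]addr0 -[0](mul0r (- c)) -hres; ring.
by field; rewrite g1 gT d0.
Qed.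

Lemma measurable_drift c t : measurable_fun (setT : set (measurableTypeR R))
  (drift c t : measurableTypeR R -> R).
Proof.
apply: continuous_measurable_fun => x.
rewrite (_ : drift c t =
    fun x => - (gradient T gamma kappa rho c t x + kappa * c) / (gamma + 1));
  last by apply/funext => y; exact: driftE.
apply: cvgM; last exact: cvg_cst.
apply: cvgN; apply: cvgD; last exact: cvg_cst.
apply: cvgM; last exact: cvg_cst.
apply: cvgM; first exact: cvg_cst.
apply: cvgB; last exact: cvg_cst.
by apply: cvgD; [exact: cvg_id|exact: cvg_cst].
Qed.

Lemma resonant_mfg_solution c : mfg_solution T gamma kappa rho s0 0
  (value T gamma kappa rho c) (state_flow c) (control_flow c).
Proof.
split.
  split.
  - exact: value_C1.
  - apply: affine_flow => // t.
      apply: cvgD; first exact: cvg_cst.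
      by apply: cvgM; [exact: cvg_id|exact: cvg_cst].
    by apply: cvgM; [exact: cvg_id|exact: cvg_cst].
  - by apply: affine_flow => // t; exact: cvg_cst.
split.
- move=> t x; rewrite in_itv/= => /andP[_ tT].
  by apply: value_HJ => //; exact: mean_control_flow.
- apply: (@affine_law_continuity_equation R T slope c initial_law (drift c)).
  + exact: hT.
  + exact: P2_initial.
  + exact: measurable_drift.
  + move=> t x; rewrite in_itv/= => /andP[_ /ltW tT].
    exact: drift_along_line.
- move=> t; rewrite in_itv/= => /andP[_ tT] A mA.
  rewrite /state_flow /control_flow /affine_law /distribution /pushforward/=.
  congr (initial_law _); apply/seteqP.
  have E x : drift c t (affine (1 + t * slope) (t * c) x) = affine slope c x.
    rewrite [affine (1 + _) _ x](_ : _ = x + t * (slope * x + c)).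
      exact: drift_along_line.
    by rewrite /affine; ring.
  by split=> x /=; rewrite -/(drift c t _) E.
- by move=> x; apply: value_terminal => //; exact: mean_state_flow.
- move=> A mA.
  rewrite /state_flow /affine_law /distribution /pushforward/=.
  rewrite [_ @^-1` A](_ : _ = A).
    by apply: eq_integral => x _; rewrite initial_density_gaussian.
  by apply/seteqP; split=> x /=; rewrite /affine !mul0r !addr0 mul1r.
Qed.

(** At time T the value is (x + rho * T * c) ^ 2 / 2; comparing x = 0 and x = 1
    isolates rho * T * c. *)
Lemma value_inj c c' :
  {in `[0, T]%classic,
    value T gamma kappa rho c =1 value T gamma kappa rho c'} -> c = c'.
Proof.
have TT : T \in `[0, T]%classic by rewrite inE/= in_itv/= lexx ltW.
move=> /(_ _ TT) vT.
have gE x : g rho x (state_flow c T) = g rho x (state_flow c' T).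
  by rewrite -(@value_terminal R T gamma kappa rho c)// ?mean_state_flow//
    -(@value_terminal R T gamma kappa rho c')// ?mean_state_flow// vT.
have := gE 1; have := gE 0; rewrite /g !mean_state_flow => g0 g1.
have rT : rho * T != 0 by rewrite mulf_neq0// gt_eqF.
by apply: (mulfI rT); move: g0 g1; rewrite !mulrA; lra.
Qed.

Lemma infinitely_many_solutions :
  infinite_set (mfg_solutions T gamma kappa rho s0 0).
Proof.
pose sol (n : nat) := (sigL `[0, T] (value T gamma kappa rho n%:R),
  @restrict_flow R T (state_flow n%:R), @restrict_flow R T (control_flow n%:R)).
apply: (@sub_infinite_set _ (range sol)).
  move=> _ [n _ <-]; exists (value T gamma kappa rho n%:R), (state_flow n%:R),
    (control_flow n%:R).
  by split => //; exact: resonant_mfg_solution.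
have sol_inj : {in setT &, injective sol}.
  by move=> n n' _ _ [/eq_sigLP/value_inj /eqP]; rewrite eqr_nat => /eqP.
apply/infiniteP; have := inj_card_eq sol_inj.
by rewrite card_eq_le => /andP[].
Qed.

End Solutions.

Theorem proposition8p2 (R : realType) (T gamma kappa rho s0 mu0 : R)
    (hT : 0 < T) (hgamma : 0 < gamma) (hkappa : kappa != 0)
    (hkappa' : kappa != - (1 + gamma)) (hrho : rho != 0) (hs0 : 0 < s0)
    (hres : 1 + kappa + gamma + T * (1 + rho) = 0) (hmu0 : mu0 = 0) :
  (forall (d : measure_display) (Om : measurableType d) (P : probability Om R),
     atomless P -> ~ displacement_semimonotone T gamma kappa rho P) /\
  infinite_set (mfg_solutions T gamma kappa rho s0 mu0).
Proof.
split; last by rewrite hmu0; exact: infinitely_many_solutions.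
by move=> d Om P _; exact: resonance_not_semimonotone.
Qed.
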